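(* Let $p$ be a prime, $S$ a finite $p$-group and $\mathcal{F}$ a saturated fusion system on $S$. Then there is a unique (up to isomorphism of $(S,S)$-bisets) minimal $\mathcal{F}$-characteristic biset $\Lambda_{\mathcal{F}}$: that is, $\Lambda_{\mathcal{F}}$ is an $\mathcal{F}$-characteristic biset, and if $\Omega$ is any $\mathcal{F}$-characteristic biset then, up to isomorphism of $(S,S)$-bisets, $\Lambda_{\mathcal{F}}\subseteq\Omega$.
   Context: Fusion systems and saturation are in the usual sense (Puig; Broto-Levi-Oliver). $\mathcal{F}(P,Q)$ denotes the set of $\mathcal{F}$-morphisms $P\to Q$ for $P,Q\le S$. All bisets are finite. An $(S,S)$-biset is a finite set $\Omega$ with a free left $S$-action and a free right $S$-action that commute; equivalently a left $(S\times S)$-set via $(b,a)\cdot\omega=b\cdot\omega\cdot a^{-1}$ on which $S\times 1$ and $1\times S$ act freely. For $P\le S$ and an injective homomorphism $\varphi\colon P\to S$, write $(P,\varphi)=\{(\varphi(a),a)\mid a\in P\}\le S\times S$. Every point-stabilizer $\mathrm{Stab}_{S\times S}(\omega)=\{(b,a)\mid b\cdot\omega=\omega\cdot a\}$ in an $(S,S)$-biset has the form $(P,\varphi)$. $\Omega^{(P,\varphi)}$ denotes the set of points fixed by $(P,\varphi)$. $\Omega$ is $\mathcal{F}$-generated if every point-stabilizer is of the form $(P,\varphi)$ with $\varphi\in\mathcal{F}(P,S)$. $\Omega$ is $\mathcal{F}$-stable if for every $P\le S$, injective homomorphism $\varphi\colon P\to S$, and $\mathcal{F}$-isomorphisms $\eta_1\colon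 Q\to P$ and $\eta_2\colon\varphi(P)\to R$, one has $|\Omega^{(P,\varphi)}|=|\Omega^{(Q,\eta_2\varphi\eta_1)}|$. $\Omega$ is $\mathcal{F}$-semicharacteristic if it is $\mathcal{F}$-generated and $\mathcal{F}$-stable, and $\mathcal{F}$-characteristic if in addition $|\Omega|/|S|\not\equiv 0\pmod p$. *)

(* Defs.v *)
(* The p-group S is a whole finGroupType, so that its subgroups are
   exactly the P : {group S}, and S itself is [set: S]. *)
From mathcomp Require Import all_boot all_fingroup all_solvable.

Set Implicit Arguments.
Unset Strict Implicit.
Unset Printing Implicit Defensive.

Import GroupScope.

(* A homomorphism P -> Q is represented by any total function S -> S with the
   right values on P; its values outside P carry no information. *)

Definition injhom (S : finGroupType) (P Q : {group S}) (phi : S -> S) : Prop :=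
  [/\ morphic P phi, {in P &, injective phi} & phi @: P \subset Q].

Definition fiso (S : finGroupType)
    (F : {group S} -> {group S} -> pred (S -> S)) (P Q : {group S}) (phi : S -> S) : Prop :=
  F P Q phi /\
  exists psi, [/\ F Q P psi, {in P, cancel phi psi} & {in Q, cancel psi phi}].

(* fhom_ext makes membership depend only on the values on the source group.
   In fhom_iso the inclusion R -> Q need not be mentioned as a factor, since
   it acts as the identity function. *)
Record fusion_system (S : finGroupType) := FusionSystem {
  fhom :> {group S} -> {group S} -> pred (S -> S);
  fhom_ext : forall (P Q : {group S}) (phi psi : S -> S),
    {in P, phi =1 psi} -> fhom P Q phi -> fhom P Q psi;
  fhom_inj : forall (P Q : {group S}) (phi : S -> S),
    fhom P Q phi -> injhom P Q phi;
  fhom_conj : forall (P Q : {group S}) (x : S),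
    P :^ x \subset Q -> fhom P Q (fun a => a ^ x);
  fhom_comp : forall (P Q R : {group S}) (phi psi : S -> S),
    fhom P Q phi -> fhom Q R psi -> fhom P R (psi \o phi);
  fhom_iso : forall (P Q : {group S}) (phi : S -> S),
    fhom P Q phi -> exists2 R : {group S}, R \subset Q & fiso fhom P R phi
}.

Definition fconj (S : finGroupType) (F : fusion_system S) (P Q : {group S}) :
    Prop :=
  exists phi, fiso F P Q phi.

Definition fully_normalized (S : finGroupType) (F : fusion_system S)
    (P : {group S}) : Prop :=
  forall Q : {group S}, fconj F P Q -> #|'N(Q)| <= #|'N(P)|.

Definition fully_centralized (S : finGroupType) (F : fusion_system S)
    (P : {group S}) : Prop :=
  forall Q : {group S}, fconj F P Q -> #|'C(Q)| <= #|'C(P)|.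

Definition AutF (S : finGroupType) (F : fusion_system S) (P : {group S}) :
    {set {perm S}} :=
  [set s in Aut P | F P P s].

Lemma AutF_group_set (S : finGroupType) (F : fusion_system S) (P : {group S}) :
  group_set (AutF F P).
Proof.
apply/group_setP; split=> [|s t].
  apply/setIdP; split; first exact: group1.
  by apply: fhom_ext (fhom_conj F (x := 1) _) => [a _|];
    rewrite ?perm1 ?conjg1 ?conjsg1.
case/setIdP=> As Fs /setIdP[At Ft]; apply/setIdP; split; first exact: groupM.
by apply: fhom_ext (fhom_comp Fs Ft) => a _; rewrite permM.
Qed.
Canonical AutF_group (S : finGroupType) (F : fusion_system S) (P : {group S}) :=
  Group (AutF_group_set F P).

Definition AutS (S : finGroupType) (P : {group S}) : {group {perm S}} :=
  (conj_aut P @* 'N(P))%G.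

(* N_phi = {g in N_S(P) | phi c_g phi^-1 in Aut_S(phi(P))}: the condition reads
   phi c_g = c_h phi on P, for some h in N_S(phi(P)). *)
Definition Nphi (S : finGroupType) (P : {group S}) (phi : S -> S) : {set S} :=
  [set g in 'N(P) | [exists h in 'N(phi @: P),
    [forall a in P, phi (a ^ g) == phi a ^ h]]].

Lemma Nphi_group_set (S : finGroupType) (P : {group S}) (phi : S -> S) :
  group_set (Nphi P phi).
Proof.
apply/group_setP; split=> [|g g'].
  apply/setIdP; split; first exact: group1.
  apply/exists_inP; exists 1; first exact: group1.
  by apply/forall_inP=> a _; rewrite !conjg1.
case/setIdP=> Ng /exists_inP[h Nh /forall_inP Hg].
case/setIdP=> Ng' /exists_inP[h' Nh' /forall_inP Hg'].
apply/setIdP; split; first exact: groupM.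
apply/exists_inP; exists (h * h'); first exact: groupM.
apply/forall_inP=> a Pa; rewrite !conjgM (eqP (Hg' _ _)) ?memJ_norm //.
by rewrite (eqP (Hg _ Pa)).
Qed.
Canonical Nphi_group (S : finGroupType) (P : {group S}) (phi : S -> S) :=
  Group (Nphi_group_set P phi).

(* The Broto-Levi-Oliver axioms; Q is the image phi(P). *)
Definition saturated (p : nat) (S : finGroupType) (F : fusion_system S) : Prop :=
  (forall P : {group S}, fully_normalized F P ->
     fully_centralized F P /\ p.-Sylow(AutF F P) (AutS P)) /\
  (forall (P Q : {group S}) (phi : S -> S),
     F P [set: S]%G phi -> phi @: P = Q -> fully_centralized F Q ->
     exists2 psi : S -> S,
       F (Nphi_group P phi) [set: S]%G psi & {in P, psi =1 phi}).

(* The right action is a library action (library actions are right actions);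
   the left action is written out. *)
Record biset (S : finGroupType) := Biset {
  bpoint :> finType;
  lact : S -> bpoint -> bpoint;
  ract : {action S &-> bpoint};
  lact1 : forall w, lact 1 w = w;
  lactM : forall b b' w, lact (b * b') w = lact b (lact b' w);
  lract : forall b a w, ract (lact b w) a = lact b (ract w a);
  lact_free : forall b w, lact b w = w -> b = 1;
  ract_free : forall a w, ract w a = w -> a = 1
}.

Definition bimorph (S : finGroupType) (X Y : biset S) (f : X -> Y) : Prop :=
  (forall b w, f (lact b w) = lact b (f w)) /\
  (forall a w, f (ract X w a) = ract Y (f w) a).

Definition biset_iso (S : finGroupType) (X Y : biset S) : Prop :=
  exists2 f : X -> Y, bimorph f & bijective f.

(* X is isomorphic to a sub-biset of Y. *)
Definition biset_sub (S : finGroupType) (X Y : biset S) : Prop :=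
  exists2 f : X -> Y, bimorph f & injective f.

(* The subgroup (P, phi) of S x S. *)
Definition twdiag (S : finGroupType) (P : {group S}) (phi : S -> S) :
    {set S * S} :=
  [set (phi a, a) | a in P].

Definition bstab (S : finGroupType) (X : biset S) (w : X) : {set S * S} :=
  [set u | lact u.1 w == ract X w u.2].

Definition bfix (S : finGroupType) (X : biset S) (H : {set S * S}) : {set X} :=
  [set w | H \subset bstab w].

Definition Fgenerated (S : finGroupType) (F : fusion_system S) (X : biset S) :
    Prop :=
  forall w : X, exists (P : {group S}) (phi : S -> S),
    F P [set: S]%G phi /\ bstab w = twdiag P phi.

(* T is the image phi(P). *)
Definition Fstable (S : finGroupType) (F : fusion_system S) (X : biset S) :
    Prop :=
  forall (P Q R T : {group S}) (phi eta1 eta2 : S -> S),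
    injhom P [set: S]%G phi -> phi @: P = T ->
    fiso F Q P eta1 -> fiso F T R eta2 ->
    #|bfix X (twdiag P phi)| = #|bfix X (twdiag Q (eta2 \o phi \o eta1))|.

Definition Fsemicharacteristic (S : finGroupType) (F : fusion_system S)
    (X : biset S) : Prop :=
  Fgenerated F X /\ Fstable F X.

(* The left action being free, the division is exact. *)
Definition Fcharacteristic (p : nat) (S : finGroupType) (F : fusion_system S)
    (X : biset S) : Prop :=
  Fsemicharacteristic F X /\ #|X| %/ #|[set: S]| <> 0 %[mod p].

(* Minimality for inclusion up to isomorphism, among F-characteristic bisets. *)
Definition minimal_Fcharacteristic (p : nat) (S : finGroupType)
    (F : fusion_system S) (X : biset S) : Prop :=
  Fcharacteristic p F X /\
  forall Y : biset S, Fcharacteristic p F Y -> biset_sub Y X -> biset_iso Y X.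

(* Main.v *)
(* An (S,S)-biset is an S x S-set, determined up to isomorphism by the numbers
   mult H of points with stabilizer H, or equivalently by its marks. Going down
   the orders of the twisted diagonals, Lambda is built from the orbits of type
   (S, phi), one for each class of phi, by adding at each order the fewest orbits
   that make the marks stable. This works because every (Q, psi) is carried to
   some (P, id) with P fully normalized by an F x F-morphism defined on the
   whole normalizer of (Q, psi): comparing the action of this normalizer on the
   fixed points of (Q, psi) and, through the morphism, on those of (P, id)
   shows that the mark of (P, id) is the larger one, by a multiple of
   |N(Q, psi) : (Q, psi)|. So nothing is added at (P, id), and the same
   comparison for the virtual difference Omega - Lambda shows by induction that
   Omega contains Lambda as soon as it has an orbit of type (S, id). Modulo p,
   |Omega| / |S| is |Out_F(S)|, which is prime to p, times the number of these
   orbits. *)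
Require Import Defs.
From mathcomp Require Import all_boot all_fingroup all_solvable.
From mathcomp Require Import zify.

Set Implicit Arguments.
Unset Strict Implicit.
Unset Printing Implicit Defensive.

Import GroupScope.

Definition mult (gT : finGroupType) (T : finType) (to : {action gT &-> T})
    (H : {group gT}) : nat :=
  #|[set x | 'C[x | to] == H :> {set gT}]|.

(** Marks of a table [t] that need not come from an action; for [mult to] they are the numbers of
    fixed points, by [mark_mult]. *)
Definition mark (gT : finGroupType) (t : {group gT} -> nat) (H : {set gT}) :
    nat :=
  \sum_(K : {group gT} | H \subset K) t K.

(** * Marks *)

Section Marks.
Variable gT : finGroupType.
Implicit Types (t u v : {group gT} -> nat) (A B C D E H K : {group gT}).

Lemma mult_pred (T : finType) (to : {action gT &-> T}) (P : pred {group gT}) :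
  \sum_(K : {group gT} | P K) mult to K = #|[set x | P 'C[x | to]%G]|.
Proof.
rewrite -sum1_card (partition_big (fun x => 'C[x | to]%G) P) => [|x] /=.
  apply: eq_bigr => K PK; rewrite /mult -sum1_card; apply: eq_bigl => x.
  rewrite !inE andbC -[LHS]/('C[x | to]%G == K).
  by case: eqP => [-> | ]; rewrite ?PK.
by rewrite inE.
Qed.

Lemma mark_mult (T : finType) (to : {action gT &-> T}) H :
  mark (mult to) H = #|'Fix_to(H)|.
Proof.
rewrite /mark mult_pred; apply: eq_card => x.
by rewrite inE sub_astab1.
Qed.

Lemma mult_gt0P (T : finType) (to : {action gT &-> T}) H :
  reflect (exists x, 'C[x | to] = H) (0 < mult to H).
Proof.
apply: (iffP card_gt0P) => -[x]; first by rewrite inE => /eqP; exists x.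
by move=> Hx; exists x; rewrite inE Hx.
Qed.

Lemma dvdn_acts (T : finType) (to : {action gT &-> T}) B (Z : {set T}) d :
  [acts B, on Z | to] -> (forall x, x \in Z -> d %| #|B : 'C_B[x | to]|) ->
  d %| #|Z|.
Proof.
move=> actsZ dZ; rewrite -(acts_sum_card_orbit actsZ).
by apply: dvdn_sum => _ /imsetP[x Zx ->]; rewrite card_orbit_in ?subsetT ?dZ.
Qed.

(** [B] normalizes [E], hence permutes these points, in orbits that all have length [#|B : E|]. *)
Lemma dvdn_capstab (T : finType) (to : {action gT &-> T}) E B :
  B \subset 'N(E) -> #|B : E| %| #|[set x | 'C_B[x | to] == E :> {set gT}]|.
Proof.
move=> nEB; apply: (@dvdn_acts _ to B) => [|x]; last by rewrite inE => /eqP->.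
apply/actsP=> b Bb x; rewrite !inE astab1_act -{1}(conjGid Bb) -conjIg.
by rewrite -{1}(normsP nEB b Bb) (inj_eq (@conjsg_inj _ b)).
Qed.

Lemma dvdn_mult (T : finType) (to : {action gT &-> T}) H :
  #|'N(H) : H| %| mult to H.
Proof.
apply: (@dvdn_acts _ to 'N(H)%G) => [|x].
  apply/actsP=> b Bb x; rewrite !inE astab1_act.
  by rewrite -{1}(normP Bb) (inj_eq (@conjsg_inj _ b)).
by rewrite inE => /eqP->; rewrite (setIidPr (normG H)).
Qed.

Lemma mark_conj t : (forall H g, t (H :^ g)%G = t H) ->
  forall H g, mark t (H :^ g) = mark t H.
Proof.
move=> tJ H g; rewrite /mark.
rewrite (reindex_inj (h := fun K => (K :^ g)%G)); last first.
  by move=> K K' /(congr1 val)/= /conjsg_inj/group_inj.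
by apply: eq_big => [K | K _] //=; rewrite conjSg.
Qed.

(** A triangular system, solved from the largest subgroups downwards: in the sums at [A], all terms
    but the one at [A] itself are already known to agree. *)
Lemma fiber_sums_inj u v D :
    (forall A, D \proper A ->
       \sum_(C : {group gT} | A \subset C) u C =
       \sum_(C : {group gT} | A \subset C) v C) ->
  forall A, D \proper A -> u A = v A.
Proof.
move=> uv A; have [n] := ubnP (#|gT| - #|A|).
elim: n => // n IHn in A *; rewrite ltnS => leAn DA.
have := uv A DA; rewrite (bigD1 A) //= [RHS](bigD1 A) //=.
rewrite (eq_bigr v) => [/addIn//|C /andP[AC neCA]].
have ltAC : A \proper C by rewrite properEneq eq_sym neCA AC.
apply: IHn (proper_trans DA ltAC); apply: leq_trans leAn.
have := proper_card ltAC; have : #|C| <= #|gT| by apply: max_card.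
by move=> leC ltC; rewrite ltn_sub2l // (leq_trans ltC).
Qed.

(* The two fibre sums count the K (weighted by t) with D as the trace of K on
   N(D), directly and through f; the other fibres match by hypothesis. *)
Lemma mark_transport t D E (f : {morphism 'N(D) >-> gT}) :
    f @* D = E ->
    (forall A, D \proper A -> A \subset 'N(D) -> mark t A = mark t (f @* A)) ->
  mark t E + \sum_(K : {group gT} | K :&: 'N(D) == D :> {set gT}) t K =
  mark t D + \sum_(K : {group gT} | f @*^-1 K == D :> {set gT}) t K.
Proof.
move=> fD tf.
pose u C := \sum_(K : {group gT} | K :&: 'N(D) == C :> {set gT}) t K.
pose v C := \sum_(K : {group gT} | f @*^-1 K == C :> {set gT}) t K.
have sum_u A : A \subset 'N(D) ->
    mark t A = \sum_(C : {group gT} | A \subset C) u C.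
  move=> nDA; rewrite /mark (partition_big (fun K => (K :&: 'N(D))%G)
    (fun C => A \subset C)) => [|K AK] /=; last by rewrite subsetI AK.
  apply: eq_bigr => C AC; apply: eq_bigl => K.
  rewrite -[X in _ && X]/(_ == C :> {set gT}) /=.
  case: eqP => [eC|]; rewrite ?andbF // andbT -(_ : A \subset C) //.
  by rewrite -eC subsetI nDA andbT.
have sum_v A : A \subset 'N(D) ->
    mark t (f @* A) = \sum_(C : {group gT} | A \subset C) v C.
  move=> nDA; rewrite /mark (partition_big (fun K => (f @*^-1 K)%G)
    (fun C => A \subset C)) => [|K AK] /=; last by rewrite -sub_morphim_pre.
  apply: eq_bigr => C AC; apply: eq_bigl => K.
  rewrite -[X in _ && X]/(_ == C :> {set gT}) /=.
  by case: eqP => [eC|]; rewrite ?andbF // andbT sub_morphim_pre // -AC -eC.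
have uv : forall A, D \proper A -> u A = v A.
  apply: fiber_sums_inj => A DA; have [nDA | nnDA] := boolP (A \subset 'N(D)).
    by rewrite -sum_u // -sum_v // tf.
  (* Both sums vanish here: traces on ['N(D)] and preimages under [f] are subgroups of ['N(D)], so
     no fibre lies over such a [C]. *)
  rewrite big1 => [|C AC]; last first.
    rewrite /u big1 // => K /eqP eC.
    by case/negP: nnDA; apply: subset_trans AC _; rewrite -eC subsetIr.
  rewrite big1 // => C AC; rewrite /v big1 // => K /eqP eC.
  by case/negP: nnDA; apply: subset_trans AC _; rewrite -eC subsetIl.
have splitD w : \sum_(C : {group gT} | D \subset C) w C =
    w D + \sum_(C : {group gT} | D \proper C) w C.
  rewrite (bigD1 D) //=; congr (_ + _); apply: eq_bigl => C.
  by rewrite properEneq andbC eq_sym.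
(* The parts strictly above [D] agree; only the two fibres over [D] remain to be exchanged. *)
rewrite -fD sum_v ?normG // sum_u ?normG // !splitD.
rewrite -[X in _ + X = _]/(u D) -[X in _ = _ + X]/(v D).
by rewrite (eq_bigr v uv) addnAC (addnC (v D)) [RHS]addnAC.
Qed.

(** The sum counts the points whose stabilizer meets [f @* 'N(D)] exactly in [E]. This group
    normalizes [E], with index equal to [#|'N(D) : D|] by injectivity. *)
Lemma fiber_sum_dvdn (T : finType) (to : {action gT &-> T}) D E
    (f : {morphism 'N(D) >-> gT}) : 'injm f -> f @* D = E ->
  #|'N(D) : D| %|
    \sum_(K : {group gT} | f @*^-1 K == D :> {set gT}) mult to K.
Proof.
move=> injf fD; rewrite mult_pred /=.
rewrite -(index_injm _ injf) ?normG // fD.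
have nE : f @* 'N(D) \subset 'N(E) by rewrite -fD morphim_norm.
rewrite (_ : [set _ | _] =
  [set x | 'C_(f @* 'N(D))[x | to] == E :> {set gT}]).
  exact: dvdn_capstab.
apply/setP=> x; rewrite !inE -fD; apply/eqP/eqP => [eD | eE].
  by rewrite -[LHS](morphpreK (subsetIl _ _)) morphpreIim eD.
by rewrite -morphpreIim eE injmK ?normG.
Qed.
End Marks.

(** * Embedding and realizing actions *)

Section Embedding.
Variable gT : finGroupType.

Lemma eq_act_stab (X Y : finType) (toX : {action gT &-> X})
    (toY : {action gT &-> Y}) x y a b :
  'C[x | toX] \subset 'C[y | toY] -> toX x a = toX x b -> toY y a = toY y b.
Proof.
move=> /subsetP sxy eab; have /sxy/astab1P eyab: a * b^-1 \in 'C[x | toX].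
  by apply/astab1P; rewrite actM eab actK.
by rewrite -{2}eyab -actM mulgKV.
Qed.

Lemma orbit_embedding (X Y : finType) (toX : {action gT &-> X})
    (toY : {action gT &-> Y}) x y :
    'C[x | toX] = 'C[y | toY] ->
  exists h : X -> Y,
    [/\ forall a, h (toX x a) = toY y a,
        {in orbit toX setT x, forall z, 'C[h z | toY] = 'C[z | toX]}
      & {in orbit toX setT x &, injective h}].
Proof.
(* Off the orbit the default 1 is harmless; on it, equality of the stabilizers makes the value
   independent of the element picked. *)
move=> exy; pose h z := toY y (odflt 1 [pick a | toX x a == z]).
have hE a : h (toX x a) = toY y a.
  rewrite /h; case: pickP => [b /eqP eb | /(_ a)]; last by rewrite eqxx.
  by apply: eq_act_stab eb; rewrite exy.
exists h; split=> // [_ /orbitP[a _ <-]|].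
  by rewrite hE !astab1_act exy.
move=> _ _ /orbitP[a _ <-] /orbitP[b _ <-]; rewrite !hE.
by apply: eq_act_stab; rewrite exy.
Qed.

(** Applied in both directions, this shows that removing two orbits with a common stabilizer lowers
    the multiplicities on both sides equally. *)
Lemma leq_orbit_mult (X Y : finType) (toX : {action gT &-> X})
    (toY : {action gT &-> Y}) x y (K : {set gT}) :
    'C[x | toX] = 'C[y | toY] ->
  #|[set z in orbit toX setT x | 'C[z | toX] == K]| <=
  #|[set z in orbit toY setT y | 'C[z | toY] == K]|.
Proof.
move=> /orbit_embedding[h [hE hC h_inj]].
rewrite -(card_in_imset (f := h)) => [|z z']; last first.
  by rewrite !inE => /andP[xz _] /andP[xz' _]; apply: h_inj.
apply: subset_leq_card; apply/subsetP=> _ /imsetP[z + ->].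
rewrite !inE => /andP[xz eK]; rewrite hC // eK andbT.
by case/orbitP: xz => a _ <-; rewrite hE mem_orbit ?inE.
Qed.

(** Induction on [#|A|]: an orbit of [A] is mapped onto an orbit of [B] with the same stabilizer,
    and both are removed. [y0] is the value of the map when [A] is empty. *)
Lemma action_embedding_in (X Y : finType) (toX : {action gT &-> X})
    (toY : {action gT &-> Y}) (y0 : Y) (A : {set X}) (B : {set Y}) :
    [acts setT, on A | toX] -> [acts setT, on B | toY] ->
    (forall H : {set gT}, #|[set x in A | 'C[x | toX] == H]| <=
                          #|[set y in B | 'C[y | toY] == H]|) ->
  exists f : X -> Y,
    [/\ {in A, forall x, f x \in B},
        {in A, forall x a, f (toX x a) = toY (f x) a}
      & {in A &, injective f}].
Proof.
have [n] := ubnP #|A|; elim: n => // n IHn in A B *; rewrite ltnS => leAn.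
move=> actA actB leAB; have [-> | [x Ax]] := set_0Vmem A.
  by exists (fun=> y0); split=> x; rewrite inE.
have [y By exy]: exists2 y, y \in B & 'C[x | toX] = 'C[y | toY].
  have /card_gt0P[y]: 0 < #|[set y in B | 'C[y | toY] == 'C[x | toX]]|.
    apply: leq_trans (leAB _); apply/card_gt0P.
    by exists x; rewrite inE Ax eqxx.
  by rewrite inE => /andP[By /eqP <-]; exists y.
pose Ox := orbit toX setT x; pose Oy := orbit toY setT y.
have actOx: [acts setT, on Ox | toX] by apply: acts_orbit; apply: subsetT.
have actOy: [acts setT, on Oy | toY] by apply: acts_orbit; apply: subsetT.
have OxJ a z : (toX z a \in Ox) = (z \in Ox).
  by apply: (actsP actOx); rewrite inE.
have OyJ a z : (toY z a \in Oy) = (z \in Oy).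
  by apply: (actsP actOy); rewrite inE.
have AJ a z : (toX z a \in A) = (z \in A) by apply: (actsP actA); rewrite inE.
have BJ a z : (toY z a \in B) = (z \in B) by apply: (actsP actB); rewrite inE.
have sOA : Ox \subset A by apply/subsetP=> _ /orbitP[a _ <-]; rewrite AJ.
have sOB : Oy \subset B by apply/subsetP=> _ /orbitP[a _ <-]; rewrite BJ.
have [h [hE hC h_inj]] := orbit_embedding exy.
have [||||f [fB fJ f_inj]] := IHn (A :\: Ox) (B :\: Oy).
- apply: leq_trans leAn; apply: proper_card; rewrite properEneq subsetDl andbT.
  by apply/eqP=> /setP/(_ x); rewrite inE Ax orbit_refl.
- by apply/actsP=> a _ z; rewrite !inE OxJ AJ.
- by apply/actsP=> a _ z; rewrite !inE OyJ BJ.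
- move=> H.
  have split (Z : finType) (to : {action gT &-> Z}) (C O : {set Z}) :
    O \subset C -> #|[set z in C | 'C[z | to] == H]| =
    #|[set z in O | 'C[z | to] == H]| + #|[set z in C :\: O | 'C[z | to] == H]|.
    move=> sOC; rewrite -(cardsID O); congr (_ + _); apply: eq_card => z.
      by rewrite !inE andbAC (andb_idl (subsetP sOC z)).
    by rewrite !inE andbA.
  have := leAB H; rewrite (split _ _ _ _ sOA) (split _ _ _ _ sOB).
  rewrite (_ : #|[set z in Ox | _]| = #|[set z in Oy | 'C[z | toY] == H]|).
    by rewrite leq_add2l.
  by apply/eqP; rewrite eqn_leq !leq_orbit_mult.
have hO z : z \in Ox -> h z \in Oy.
  by case/orbitP=> a _ <-; rewrite hE mem_orbit ?inE.
exists (fun z => if z \in Ox then h z else f z).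
split=> [z Az | z Az a | z z' Az Az'].
- case: ifPn => [/hO/(subsetP sOB) // | nOz].
  by have := fB z; rewrite !inE nOz Az => /(_ isT)/andP[].
- rewrite OxJ; case: ifPn => [/orbitP[b _ <-] | nOz].
    by rewrite -actM !hE actM.
  by rewrite fJ // inE nOz.
case: ifPn => Oz; case: ifPn => Oz' ezz'.
- exact: h_inj.
- by have := fB z'; rewrite -ezz' !inE Oz' Az' hO // => /(_ isT).
- by have := fB z; rewrite ezz' !inE Oz Az hO // => /(_ isT).
by apply: f_inj; rewrite // inE ?Oz ?Oz'.
Qed.

Lemma action_embedding (X Y : finType) (toX : {action gT &-> X})
    (toY : {action gT &-> Y}) :
    (forall H, mult toX H <= mult toY H) ->
  exists2 f : X -> Y, forall x a, f (toX x a) = toY (f x) a & injective f.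
Proof.
(* If [X] is empty, [Y] may have no point to serve as default, and the map is the empty one. *)
move=> leXY; have [x0 _ | noX] := pickP (@predT X); last first.
  by exists (fun x => False_rect Y (notF (esym (noX x)))) => x; have := noX x.
have [y0 _]: exists y, 'C[y | toY] = 'C[x0 | toX].
  apply/(@mult_gt0P _ _ _ 'C[x0 | toX]%G); apply: leq_trans (leXY _).
  by apply/mult_gt0P; exists x0.
have [|||f [_ fJ f_inj]] := @action_embedding_in _ _ toX toY y0 setT setT.
- by apply/actsP=> a _ x; rewrite !inE.
- by apply/actsP=> a _ x; rewrite !inE.
- move=> H.
  have mE (Z : finType) (to : {action gT &-> Z}) :
      #|[set z in setT | 'C[z | to] == H]| =
      if group_set H then mult to <<H>> else 0.
    case: ifPn => [gH | ngH].
      by apply: eq_card => z; rewrite !inE /= gen_set_id.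
    apply: eq_card0 => z; rewrite !inE /=; apply: contraNF ngH => /eqP <-.
    exact: groupP.
  by rewrite !mE; case: ifP.
by exists f => [x a | x x']; [apply: fJ | apply: f_inj]; rewrite inE.
Qed.
End Embedding.

Section Realization.
Variable gT : finGroupType.

(** The [pick] depends on the conjugacy class only, so conjugate sets share their representative;
    the default is never reached, since [H] lies in its class. *)
Definition class_repr (H : {set gT}) : {set gT} :=
  odflt H [pick K in H :^: [set: gT]].

Lemma class_repr_conj H x : class_repr (H :^ x) = class_repr H.
Proof.
rewrite /class_repr.
have eHx : (H :^ x) :^: [set: gT] = H :^: [set: gT].
  by rewrite conjugates_conj lcoset_id ?inE.
rewrite eHx; case: pickP => // /(_ H) /imsetP[]; exists 1; rewrite ?inE //.
by rewrite conjsg1.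
Qed.

Lemma class_reprP H : exists x, class_repr H = H :^ x.
Proof.
rewrite /class_repr; case: pickP => [K /imsetP[x _ ->] | _]; first by exists x.
by exists 1; rewrite conjsg1.
Qed.

(* Right cosets H g (H running over class representatives) come in t H / |N(H):H|
   copies; g ranging over N(H) gives the stabilizer H exactly |N(H):H| times. *)
Lemma realization (t : {group gT} -> nat) :
    (forall H x, t (H :^ x)%G = t H) ->
    (forall H : {group gT}, #|'N(H) : H| %| t H) ->
  exists (T : finType) (to : {action gT &-> T}), forall H, mult to H = t H.
Proof.
move=> tJ t_dvd.
pose c (H : {group gT}) := t H %/ #|'N(H) : H|.
(* A common bound on the numbers of copies, so that one index type serves all subgroups. *)
pose m := \sum_(H : {group gT}) c H.
have cm H : c H <= m by rewrite /m (bigD1 H) ?leq_addr.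
pose P (u : {set gT} * 'I_m) := [exists H : {group gT},
  [&& class_repr H == H, u.1 \in rcosets H setT & u.2 < c H]].
pose T := {u : {set gT} * 'I_m | P u}.
have PJ (u : T) a : P ((val u).1 :* a, (val u).2).
  have /existsP[H /and3P[rH /rcosetsP[g _ eu] cu]] := valP u.
  apply/existsP; exists H; rewrite rH cu andbT /= eu -rcosetM.
  by apply/rcosetsP; exists (g * a); rewrite ?inE.
pose act (u : T) a : T := Sub ((val u).1 :* a, (val u).2) (PJ u a).
have act1 : act^~ 1 =1 id.
  by move=> u; apply: val_inj; rewrite SubK mulg1 -surjective_pairing.
have actM u a b : act u (a * b) = act (act u a) b.
  by apply: val_inj; rewrite !SubK rcosetM.
pose to := TotalAction act1 actM.
have stabE (u : T) (H : {group gT}) g :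
  (val u).1 = H :* g -> 'C[u | to] = H :^ g.
  move=> eu; apply/setP=> a; rewrite mem_conjg conjgE invgK mulgA.
  apply/astab1P/idP => [/(congr1 (fun v : T => (val v).1)) /= | Ha].
    by rewrite eu -rcosetM -mem_rcoset => <-; apply: rcoset_refl.
  apply: val_inj; rewrite SubK [RHS]surjective_pairing eu; congr (_, _).
  by rewrite -rcosetM; apply: rcoset_eqP; rewrite mem_rcoset.
exists T, to => K.
(* With [H0] the representative of the class of [K], the points with stabilizer [K] are the copies
   [k < c H0] of the cosets [H0 :* n :* x^-1], for [n] in ['N(H0)]. *)
have [x eKx] := class_reprP K; pose H0 := (K :^ x)%G.
have H0K : H0 :^ x^-1 = K by rewrite /= conjsgK.
have -> : t K = (#|'N(H0) : H0| * c H0)%N by rewrite mulnC divnK // -(tJ K x).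
have <- : #|[set k : 'I_m | k < c H0]| = c H0.
  by rewrite -sum1dep_card (big_ord_narrow (cm H0)) sum1_card card_ord.
have rcoset_inj : injective (fun A : {set gT} => A :* x^-1).
  by apply: (can_inj (g := fun A => A :* x)) => A; rewrite rcosetKV.
rewrite /indexg -(card_imset _ rcoset_inj).
rewrite -cardsX /mult -(card_imset _ val_inj); apply: eq_card => -[A k].
apply/imsetP/setXP => /= [[u + eAk] | [/imsetP[_ /rcosetsP[n Nn ->] ->]]].
  rewrite !inE; have /existsP[H /and3P[/eqP rH /rcosetsP[g _ eu] cu]] := valP u.
  rewrite (stabE _ _ _ eu) => /eqP eK.
  have eH : H = H0.
    apply: group_inj; rewrite -[LHS]rH /= -eKx -eK class_repr_conj //.
  have eA : A = (val u).1 by apply: (congr1 fst eAk).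
  have ek : k = (val u).2 by apply: (congr1 snd eAk).
  split; last by rewrite ek -eH.
  rewrite eA eu.
  have Ngx : g * x \in 'N(H0) by apply/normP; rewrite -{1}eH conjsgM eK.
  apply/imsetP; exists (H0 :* (g * x)); last by rewrite -rcosetM mulgK eH.
  by apply/rcosetsP; exists (g * x).
rewrite !inE => cu.
have PA : P (H0 :* n :* x^-1, k).
  apply/existsP; exists H0; rewrite cu andbT /= class_repr_conj eKx eqxx.
  by rewrite -rcosetM; apply/rcosetsP; exists (n * x^-1); rewrite ?inE.
exists (Sub _ PA : T); last by rewrite SubK.
rewrite inE (stabE _ H0 (n * x^-1)) ?SubK ?rcosetM //.
by rewrite conjsgM (normP Nn) H0K.
Qed.
End Realization.

(** * Minimal stable actions *)

Section MinimalStable.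
Variables (gT : finGroupType) (p : nat).
(** To be instantiated with the twisted diagonals of F-morphisms, with F x F-conjugacy, and with the
    [(P, id)] for [P] fully normalized. *)
Variables (D : pred {group gT}) (R : rel {group gT}) (rep : {group gT} -> Prop).
(* s H is the number of points added at H on top of the least stable value. *)
Variable s : {group gT} -> nat.
Implicit Types (t : {group gT} -> nat) (A E H K : {group gT}).

Hypothesis pG : p.-group [set: gT].
Hypothesis DS : forall H K, H \subset K -> D K -> D H.
Hypothesis DR : forall H K, R H K -> D H -> D K.
Hypothesis R_refl : reflexive R.
Hypothesis R_sym : symmetric R.
Hypothesis R_trans : transitive R.
Hypothesis R_card : forall H K, R H K -> #|H| = #|K|.
Hypothesis R_conj : forall H x, R H (H :^ x)%G.
Hypothesis repD : forall E, rep E -> D E.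
Hypothesis rep_exists : forall H, D H -> exists2 E, R H E & rep E.
Hypothesis rep_transport : forall E H, rep E -> R H E -> D H ->
  exists f : {morphism 'N(H) >-> gT},
    [/\ 'injm f, f @* H = E
      & forall A, H \subset A -> A \subset 'N(H) -> R A (f @* A)%G].
Hypothesis sR : forall H K, R H K -> s H = s K.
Hypothesis s_dvd : forall H, D H -> #|'N(H) : H| %| s H.

Definition stable_from n t :=
  forall H K, R H K -> n <= #|H| -> mark t H = mark t K.

Definition supported t := forall H, 0 < t H -> D H.

Lemma mark_eq0 t H : supported t -> ~~ D H -> mark t H = 0.
Proof.
move=> tD nDH; apply: big1 => K sHK; apply/eqP; rewrite -leqn0 leqNgt.
by apply: contra nDH => /tD; apply: DS.
Qed.

(** A subgroup [A] of ['N(H)] strictly above [H] is [R]-related to [f @* A] and has order at least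
    [#|H|.+1], where marks are already stable. *)
Lemma mark_transport_rep t H E : stable_from #|H|.+1 t ->
    rep E -> R H E -> D H ->
  exists f : {morphism 'N(H) >-> gT}, [/\ 'injm f, f @* H = E &
  mark t E + \sum_(K : {group gT} | K :&: 'N(H) == H :> {set gT}) t K =
  mark t H + \sum_(K : {group gT} | f @*^-1 K == H :> {set gT}) t K].
Proof.
move=> tst repE RHE DH; have [f [injf fH fR]] := rep_transport repE RHE DH.
exists f; split=> //; apply: mark_transport => // A HA NA.
by apply: tst (proper_card HA); apply: fR (proper_sub HA) NA.
Qed.

(** Normalizers grow in a p-group: a [K] strictly above [H] meets ['N(H)] in more than [H]. *)
Lemma normal_trace_eq0 t H : (forall K, 0 < t K -> #|H| < #|K|) ->
  \sum_(K : {group gT} | K :&: 'N(H) == H :> {set gT}) t K = 0.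
Proof.
move=> tH; apply: big1 => K /eqP eH; apply/eqP; rewrite -leqn0 leqNgt.
apply/negP=> /tH ltHK; have sHK : H \subset K by rewrite -eH subsetIl.
have /nilpotent_proper_norm/(_ _)/proper_card: nilpotent K.
  exact: pgroup_nil (pgroupS (subsetT K) pG).
by move/(_ H); rewrite eH ltnn properEcard sHK ltHK => /(_ isT).
Qed.

(** Once the trace sum vanishes, the two marks differ by the fibre sum over [f], which is a natural
    number. *)
Lemma leq_mark_rep t H E : stable_from #|H|.+1 t ->
    (forall K, 0 < t K -> #|H| < #|K|) -> rep E -> R H E -> D H ->
  mark t H <= mark t E.
Proof.
move=> tst tH repE RHE DH; have [f [_ _]] := mark_transport_rep tst repE RHE DH.
by rewrite normal_trace_eq0 // addn0 => ->; apply: leq_addr.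
Qed.

(** The difference is the fibre sum over [f]; realizing [t] by an action makes [fiber_sum_dvdn]
    applicable. *)
Lemma dvdn_mark_rep t H E :
    (forall K x, t (K :^ x)%G = t K) -> (forall K, #|'N(K) : K| %| t K) ->
    stable_from #|H|.+1 t -> (forall K, 0 < t K -> #|H| < #|K|) ->
    rep E -> R H E -> D H ->
  #|'N(H) : H| %| mark t E - mark t H.
Proof.
move=> tJ t_dvd tst tH repE RHE DH.
have [f [injf fH]] := mark_transport_rep tst repE RHE DH.
rewrite normal_trace_eq0 // addn0 => ->; rewrite addKn.
have [T [to toE]] := realization tJ t_dvd.
by rewrite (eq_bigr (mult to)) ?(fiber_sum_dvdn to injf fH).
Qed.

Lemma mark_top t H n : #|H| = n ->
  mark t H = t H + mark (fun K => if n < #|K| then t K else 0) H.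
Proof.
move=> cH; rewrite /mark (bigD1 H) //=; congr (_ + _).
rewrite [RHS](bigD1 H) //= cH ltnn add0n; apply: eq_bigr => K /andP[sHK neKH].
rewrite -cH; case: ifPn => // /negP[]; apply: proper_card.
by rewrite properEneq eq_sym neKH.
Qed.

(** The actions into which the minimal one has to embed. *)
Definition dominated (Y : finType) (toY : {action gT &-> Y}) :=
  [/\ forall x, D 'C[x | toY]%G,
      forall H K, R H K -> #|'Fix_toY(H)| = #|'Fix_toY(K)|
    & forall E, rep E -> s E <= mult toY E].

(** Descending induction on [n], starting from the zero table beyond [#|gT|]: each step changes the
    table at order [n] only. *)
Lemma minimal_table n : exists t,
  [/\ (forall H x, t (H :^ x)%G = t H) /\ (forall H, #|'N(H) : H| %| t H),
      supported t /\ (forall H, 0 < t H -> n <= #|H|), stable_from n t,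
      forall E, rep E -> n <= #|E| -> t E = s E
    & forall (Y : finType) (toY : {action gT &-> Y}), dominated toY ->
        forall H, t H <= mult toY H].
Proof.
have [k] := ubnP (#|gT|.+1 - n); elim: k => // k IHk in n *.
have [ltGn _ | ] := ltnP #|gT| n.
  exists (fun=> 0); split=> //; first by move=> H K _ _; rewrite /mark !big1.
  by move=> E _ /leq_trans/(_ (max_card _)); rewrite leqNgt ltGn.
move=> lenG; rewrite ltnS => lek.
have [|t [[tJ t_dvd] [tD tn] tst tE tmin]] := IHk n.+1; first by lia.
pose M H := \max_(E | R H E) mark t E.
have tn0 H : #|H| = n -> t H = 0.
  move=> cH; apply/eqP; rewrite -leqn0 leqNgt; apply/negP=> /tn.
  by rewrite cH ltnn.
have MR H K : R H K -> M H = M K.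
  move=> RHK; apply: eq_bigl => E; apply/idP/idP; last exact: R_trans.
  by apply: R_trans; rewrite R_sym.
have leME H K : R H K -> mark t K <= M H.
  by move=> RHK; rewrite /M (bigD1 K) //= leq_maxl.
(* By [leq_mark_rep], the largest mark in a class is attained at the representative. *)
have ME H E : #|H| = n -> D H -> rep E -> R H E -> M H = mark t E.
  move=> cH DH repE RHE; apply/eqP; rewrite eqn_leq; apply/andP; split.
    apply/bigmax_leqP=> K RHK; have cK : #|K| = n by rewrite -(R_card RHK).
    apply: leq_mark_rep; rewrite ?cK //; last exact: DR DH.
    by apply: R_trans RHE; rewrite R_sym.
  exact: leME.
have leM H : mark t H <= M H by apply: leME.
(* The new value raises the mark of [H] to [M H + s H]; the subtraction is exact by [leM]. *)
pose t' H := if (#|H| == n) && D H then M H + s H - mark t H else t H.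
have t'n H : 0 < t' H -> n <= #|H|.
  by rewrite /t'; case: ifP => [/andP[/eqP->]|_ /tn/ltnW].
have markS H : n < #|H| -> mark t' H = mark t H.
  move=> ltnH; apply: eq_bigr => K /subset_leq_card/(leq_trans ltnH) ltnK.
  by rewrite /t' gtn_eqF.
have markn H : #|H| = n -> D H -> mark t' H = M H + s H.
  move=> cH DH; rewrite (mark_top t' cH) {1}/t' cH eqxx DH /=.
  rewrite (_ : mark _ H = mark t H) ?subnK //.
    exact: leq_trans (leM _) (leq_addr _ _).
  rewrite [RHS](mark_top t cH) tn0 // add0n.
  by apply: eq_bigr => K _; rewrite /t'; case: ifPn => // ltnK; rewrite gtn_eqF.
have t'D : supported t'.
  by move=> H; rewrite /t'; case: ifP => [/andP[] | _ /tD].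
exists t'; split=> //.
- split=> [H x | H]; rewrite /t'.
    rewrite cardJg tJ -(MR _ _ (R_conj H x)) -(sR (R_conj H x)) mark_conj //.
    congr (if _ && _ then _ else _); apply/idP/idP; last exact: DR.
    by apply: DR; rewrite R_sym.
  case: ifP => [/andP[/eqP cH DH] | _]; last exact: t_dvd.
  have [E RHE repE] := rep_exists DH.
  (* [s H] and [M H - mark t H] are divisible separately, the latter as a difference of the marks of
     [E] and [H]. *)
  rewrite addnC -addnBA ?leM // dvdn_addr ?s_dvd //.
  by rewrite (ME H E) // dvdn_mark_rep // cH.
- move=> H K RHK; rewrite leq_eqVlt => /predU1P[cH | ltnH]; last first.
    by rewrite !markS -?(R_card RHK) //; apply: tst.
  have [DH | nDH] := boolP (D H).
    have DK := DR RHK DH.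
    by rewrite !markn -?(R_card RHK) // (MR H K) // (sR RHK).
  rewrite !mark_eq0 //; apply: contra nDH; apply: DR; by rewrite R_sym.
- move=> E repE; rewrite leq_eqVlt => /predU1P[cE | ltnE].
    by rewrite /t' -cE eqxx repD // (ME E E) ?repD // addKn.
  by rewrite /t' gtn_eqF //= tE.
move=> Y toY domY H; rewrite /t'.
case: ifP => [/andP[/eqP cH DH] | _]; last exact: tmin.
have [DC YR Ys] := domY; have [E RHE repE] := rep_exists DH.
have cE : #|E| = n by rewrite -(R_card RHE).
pose m K := if n < #|K| then mult toY K else 0.
(* The virtual difference above order [n]: the subtraction is exact by [tmin], and the marks of [d]
   are stable as differences of stable marks. *)
pose d K := if n < #|K| then mult toY K - t K else 0.
have markd K : mark m K = mark d K + mark t K.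
  rewrite /mark -big_split; apply: eq_bigr => L _ /=; rewrite /m /d.
  case: ifP => [_ | leLn]; first by rewrite subnK ?tmin.
  rewrite add0n; apply/esym/eqP; rewrite -leqn0 leqNgt.
  by apply/negP=> /tn; rewrite leLn.
have markm K : n < #|K| -> mark m K = mark (mult toY) K.
  move=> ltnK; apply: eq_bigr => L /subset_leq_card/(leq_trans ltnK) ltnL.
  by rewrite /m ltnL.
have led : mark d H <= mark d E.
  apply: leq_mark_rep => // [A B RAB | K]; rewrite cH; last first.
    by rewrite /d; case: ifP.
  move=> ltnA; apply/(@addIn (mark t A)); rewrite -markd (tst A B) // -markd.
  by rewrite !markm -?(R_card RAB) // !mark_mult (YR A B).
(* Since [toY] has equal marks at [H] and [E], [mult toY H] is the sum of [mult toY E], which is at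
   least [s H], of [mark d E - mark d H], which is nonnegative, and of [M H - mark t H]. *)
have := mark_top (mult toY) cH; have := mark_top (mult toY) cE.
rewrite -/m (ME H E) // !markd !mark_mult (YR H E) // (sR RHE).
have := Ys E repE; lia.
Qed.

Lemma minimal_stable_action : exists (T : finType) (to : {action gT &-> T}),
  [/\ forall x, D 'C[x | to]%G,
      forall H K, R H K -> #|'Fix_to(H)| = #|'Fix_to(K)|,
      forall E, rep E -> mult to E = s E
    & forall (Y : finType) (toY : {action gT &-> Y}), dominated toY ->
        exists2 f : T -> Y, forall x a, f (to x a) = toY (f x) a & injective f].
Proof.
have [t [[tJ t_dvd] [tD _] tst tE tmin]] := minimal_table 0.
have [T [to toE]] := realization tJ t_dvd.
exists T, to; split=> [x | H K RHK | E repE | Y toY domY].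
- by apply: tD; rewrite -toE; apply/mult_gt0P; exists x.
- have mE L : mark (mult to) L = mark t L by apply: eq_bigr => E _; apply: toE.
  by rewrite -!mark_mult !mE; apply: tst RHK _.
- by rewrite toE tE.
by apply: action_embedding => H; rewrite toE tmin.
Qed.
End MinimalStable.

(** * Morphisms of fusion systems *)

Section FusionMaps.
Variables (S : finGroupType) (F : fusion_system S).
Implicit Types (P Q R : {group S}) (phi psi eta : S -> S).

Notation FT P phi := (F P [set: S]%G phi).

Lemma fhom_sub P Q : P \subset Q -> F P Q id.
Proof.
move=> sPQ; apply: fhom_ext (fhom_conj F (x := 1) (P := P) (Q := Q) _).
  by move=> a _; rewrite conjg1.
by rewrite conjsg1.
Qed.

Lemma fhomT P Q phi : F P Q phi -> FT P phi.
Proof. by move=> Fphi; apply: fhom_comp Fphi (fhom_sub (subsetT Q)). Qed.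

Lemma fhom_res P P' Q phi : P' \subset P -> F P Q phi -> F P' Q phi.
Proof. by move=> sP; apply: fhom_comp (fhom_sub sP). Qed.

Lemma fhomM P Q phi : F P Q phi -> {in P &, {morph phi : x y / x * y}}.
Proof. by case/fhom_inj=> /morphicP. Qed.

Lemma fhom_injP P Q phi : F P Q phi -> {in P &, injective phi}.
Proof. by case/fhom_inj. Qed.

Lemma fhom1 P Q phi : F P Q phi -> phi 1 = 1.
Proof.
by move=> Fphi; apply: (mulgI (phi 1)); rewrite -(fhomM Fphi) ?group1 // !mulg1.
Qed.

Lemma fhomJ P Q phi x y : F P Q phi -> x \in P -> y \in P ->
  phi (x ^ y) = phi x ^ phi y.
Proof.
move=> Fphi Px Py; apply: (mulgI (phi y)).
by rewrite -(fhomM Fphi) ?groupJ // -!conjgC (fhomM Fphi).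
Qed.

(** The inverse comes from [fhom_iso], whose subgroup [R] has to be the image. Isomorphisms can thus
    be handled as morphisms into the whole group with a prescribed image. *)
Lemma fisoP P Q phi : fiso F P Q phi <-> FT P phi /\ phi @: P = Q.
Proof.
split=> [[Fphi [psi [Fpsi phiK psiK]]] | [Fphi imphi]].
  split; first exact: fhomT Fphi.
  have [_ _ sPQ] := fhom_inj Fphi; have [_ _ /subsetP sQP] := fhom_inj Fpsi.
  apply/eqP; rewrite eqEsubset sPQ; apply/subsetP=> q Qq.
  by rewrite -(psiK q Qq) imset_f // sQP ?imset_f.
have [R _ [Fphi' [psi [Fpsi phiK psiK]]]] := fhom_iso Fphi.
suff -> : Q = R by split=> //; exists psi.
have [_ _ sPR] := fhom_inj Fphi'; have [_ _ /subsetP sRP] := fhom_inj Fpsi.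
apply: group_inj; rewrite -imphi; apply/eqP; rewrite eqEsubset sPR.
by apply/subsetP=> q Rq; rewrite -(psiK q Rq) imset_f // sRP ?imset_f.
Qed.

Lemma fiso_sym P Q phi : fiso F P Q phi ->
  exists psi,
    [/\ fiso F Q P psi, {in P, cancel phi psi} & {in Q, cancel psi phi}].
Proof.
case=> Fphi [psi [Fpsi phiK psiK]].
by exists psi; split=> //; split=> //; exists phi.
Qed.

Lemma fhom_image P phi :
  FT P phi -> exists2 Q : {group S}, phi @: P = Q & fiso F P Q phi.
Proof. by move=> /fhom_iso[Q _ isoQ]; exists Q => //; case/fisoP: isoQ. Qed.

Lemma fhomT_comp P Q phi psi : FT P phi -> phi @: P \subset Q -> FT Q psi ->
  FT P (psi \o phi).
Proof.
move=> Fphi sPQ Fpsi; have [R eR [FR _]] := fhom_image Fphi.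
by apply: fhom_comp FR (fhom_res _ Fpsi); rewrite -eR.
Qed.

Lemma fiso_comp P Q R phi psi :
  fiso F P Q phi -> fiso F Q R psi -> fiso F P R (psi \o phi).
Proof.
move=> /fisoP[Fphi eQ] /fisoP[Fpsi eR]; apply/fisoP; split.
  by apply: fhomT_comp Fphi _ Fpsi; rewrite eQ.
by rewrite imset_comp eQ.
Qed.

Lemma fconj_trans P Q R : fconj F P Q -> fconj F Q R -> fconj F P R.
Proof.
case=> phi isophi [psi isopsi].
by exists (psi \o phi); apply: fiso_comp isopsi.
Qed.

(** Restricting to finite functions turns the existence of suitable F-morphisms into a boolean. *)
Lemma fhom_ffun P Q phi : F P Q phi -> F P Q [ffun x => phi x].
Proof. by apply: fhom_ext => x _; rewrite ffunE. Qed.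

Lemma fully_normalized_exists P :
  exists2 Q, fconj F P Q & fully_normalized F Q.
Proof.
pose c Q := [exists phi : {ffun S -> S}, FT P phi && (phi @: P == Q)].
have cP Q : reflect (fconj F P Q) (c Q).
  apply: (iffP existsP) => [[phi /andP[Fphi /eqP eQ]] | [phi /fisoP[Fphi eQ]]].
    by exists phi; apply/fisoP.
  exists [ffun x => phi x]; rewrite fhom_ffun //= -eQ.
  by apply/eqP/eq_imset => x; rewrite ffunE.
have cPP : c P.
  by apply/cP; exists id; apply/fisoP; rewrite imset_id fhom_sub ?subsetT.
case: (arg_maxnP (fun Q : {group S} => #|'N(Q)|) cPP) => Q /cP PQ maxQ.
by exists Q => // R QR; apply: maxQ; apply/cP; apply: fconj_trans QR.
Qed.

End FusionMaps.

(** * Twisted diagonals and their F x F-conjugacy *)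

Section TwistedDiagonals.
Variables (S : finGroupType) (F : fusion_system S).
Implicit Types (P Q : {group S}) (phi psi : S -> S) (H K : {group S * S}).
Notation FT P phi := (F P [set: S]%G phi).

Definition proj1 H : {group S} := (fst @* H)%G.
Definition proj2 H : {group S} := (snd @* H)%G.

Lemma proj1E H : proj1 H = fst @: H :> {set S}.
Proof. by rewrite /= morphimEsub ?subsetT. Qed.

Lemma proj2E H : proj2 H = snd @: H :> {set S}.
Proof. by rewrite /= morphimEsub ?subsetT. Qed.

Lemma mem_proj1 H u : u \in H -> u.1 \in proj1 H.
Proof. by move=> Hu; rewrite proj1E imset_f. Qed.

Lemma mem_proj2 H u : u \in H -> u.2 \in proj2 H.
Proof. by move=> Hu; rewrite proj2E imset_f. Qed.

Definition map_pair (rho chi : S -> S) (u : S * S) := (rho u.1, chi u.2).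

(* F x F-conjugacy of subgroups of S x S. *)
Definition biconj H K :=
  [exists rho : {ffun S -> S}, [exists chi : {ffun S -> S},
    [&& FT (proj1 H) rho, FT (proj2 H) chi & map_pair rho chi @: H == K]]].

Lemma biconjP H K : reflect
  (exists rho chi, [/\ FT (proj1 H) rho, FT (proj2 H) chi
                     & map_pair rho chi @: H = K])
  (biconj H K).
Proof.
apply: (iffP existsP) => [[rho /existsP[chi /and3P[? ? /eqP ?]]] | ].
  by exists rho, chi.
move=> [rho [chi [Fr Fc eK]]].
exists [ffun x => rho x]; apply/existsP; exists [ffun x => chi x].
rewrite !fhom_ffun //= -eK; apply/eqP/eq_imset => u.
by rewrite /map_pair !ffunE.
Qed.

(** The stabilizers permitted in an F-generated biset, as a boolean predicate. *)
Definition Fdiag H := [exists P : {group S}, [exists phi : {ffun S -> S},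
  FT P phi && (H == twdiag P phi :> {set S * S})]].

Lemma FdiagP H : reflect
  (exists P phi, FT P phi /\ H = twdiag P phi :> {set S * S}) (Fdiag H).
Proof.
apply: (iffP existsP) => [[P /existsP[phi /andP[Fphi /eqP eH]]] | ].
  by exists P, phi.
move=> [P [phi [Fphi eH]]].
exists P; apply/existsP; exists [ffun x => phi x].
by rewrite fhom_ffun //= eH; apply/eqP/eq_imset => u; rewrite ffunE.
Qed.

Lemma mem_twdiag P phi u : (u \in twdiag P phi) = (u.2 \in P) && (u.1 == phi u.2).
Proof.
apply/imsetP/andP => [[a Pa ->] | [Pa /eqP e1]] //=.
by exists u.2; rewrite // -e1; case: u {Pa e1}.
Qed.

Lemma proj1_twdiag H P phi :
  H = twdiag P phi :> {set S * S} -> proj1 H = phi @: P :> {set S}.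
Proof. by move=> eH; rewrite proj1E eH -imset_comp. Qed.

Lemma proj2_twdiag H P phi :
  H = twdiag P phi :> {set S * S} -> proj2 H = P.
Proof.
by move=> eH; apply: group_inj; rewrite proj2E eH -imset_comp -[RHS]imset_id.
Qed.

Lemma card_twdiag P phi : #|twdiag P phi| = #|P|.
Proof. by rewrite card_imset // => a b []. Qed.

Lemma twdiag_group_set P phi :
  {in P &, {morph phi : x y / x * y}} -> group_set (twdiag P phi).
Proof.
move=> phiM; have phi1 : phi 1 = 1.
  by apply: (mulgI (phi 1)); rewrite -phiM ?group1 // !mulg1.
apply/group_setP; split=> [|u v]; first by rewrite mem_twdiag group1 phi1 eqxx.
rewrite !mem_twdiag => /andP[Pu /eqP eu] /andP[Pv /eqP ev].
by rewrite groupM //= eu ev phiM.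
Qed.

(** Here [eta] is [rho phi chi^-1], characterized without the inverse. *)
Lemma map_pair_twdiag P Q phi rho chi eta :
    chi @: P = Q -> {in P, forall x, eta (chi x) = rho (phi x)} ->
  map_pair rho chi @: twdiag P phi = twdiag Q eta.
Proof.
move=> imQ eE; rewrite /twdiag -imQ -!imset_comp; apply: eq_in_imset => x Px /=.
by rewrite /map_pair /= eE.
Qed.

(** A subgroup of the graph of [phi] is the graph of [phi] on its second projection. *)
Lemma Fdiag_sub H K : H \subset K -> Fdiag K -> Fdiag H.
Proof.
move=> sHK /FdiagP[P [phi [Fphi eK]]]; apply/FdiagP; exists (proj2 H), phi.
have sP : proj2 H \subset P by rewrite -(proj2_twdiag eK) morphimS.
split; first exact: fhom_res Fphi.
apply/setP=> u; rewrite mem_twdiag; apply/idP/andP => [Hu | [Pu /eqP eu]].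
  by rewrite mem_proj2 //; have := subsetP sHK u Hu; rewrite eK mem_twdiag => /andP[].
move: Pu; rewrite proj2E => /imsetP[v Hv ev].
have := subsetP sHK v Hv; rewrite eK mem_twdiag -ev -eu => /andP[_ /eqP ev1].
by rewrite [u]surjective_pairing ev -ev1 -surjective_pairing.
Qed.

Lemma biconj_refl : reflexive biconj.
Proof.
move=> H; apply/biconjP; exists id, id; rewrite !fhom_sub ?subsetT //; split=> //.
by rewrite -[RHS]imset_id; apply: eq_imset => -[].
Qed.

Lemma biconj_proj H K rho chi : map_pair rho chi @: H = K ->
  rho @: proj1 H = proj1 K /\ chi @: proj2 H = proj2 K.
Proof. by rewrite !proj1E !proj2E => <-; split; rewrite -!imset_comp. Qed.

Lemma biconj_trans : transitive biconj.
Proof.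
move=> K H L /biconjP[r [c [Fr Fc eK]]] /biconjP[r' [c' [Fr' Fc' eL]]].
have [e1 e2] := biconj_proj eK.
apply/biconjP; exists (r' \o r), (c' \o c); split.
- by apply: fhomT_comp Fr _ Fr'; rewrite e1.
- by apply: fhomT_comp Fc _ Fc'; rewrite e2.
by rewrite -eL -eK -imset_comp.
Qed.

Lemma biconj_sym : symmetric biconj.
Proof.
suff sym H K : biconj H K -> biconj K H.
  by move=> H K; apply/idP/idP; apply: sym.
case/biconjP=> r [c [Fr Fc eK]]; have [e1 e2] := biconj_proj eK.
have /fiso_sym[r' [/fisoP[Fr' _] rK _]]: fiso F (proj1 H) (proj1 K) r.
  by apply/fisoP.
have /fiso_sym[c' [/fisoP[Fc' _] cK _]]: fiso F (proj2 H) (proj2 K) c.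
  by apply/fisoP.
apply/biconjP; exists r', c'; split=> //; rewrite -eK -imset_comp -[RHS]imset_id.
apply: eq_in_imset => u Hu; rewrite /map_pair /= rK ?cK ?mem_proj1 ?mem_proj2 //.
by rewrite -surjective_pairing.
Qed.

Lemma biconj_card H K : biconj H K -> #|H| = #|K|.
Proof.
case/biconjP=> r [c [Fr Fc <-]]; rewrite card_in_imset // => u v Hu Hv [].
move=> /(fhom_injP Fr (mem_proj1 Hu) (mem_proj1 Hv)) e1.
move=> /(fhom_injP Fc (mem_proj2 Hu) (mem_proj2 Hv)) e2.
by rewrite [u]surjective_pairing e1 e2 -surjective_pairing.
Qed.

Lemma biconj_conj H x : biconj H (H :^ x)%G.
Proof.
apply/biconjP; exists (conjg^~ x.1), (conjg^~ x.2).
by split; try by apply: fhom_conj; apply: subsetT.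
Qed.

(** Stability composes [phi] with [eta1] at the source, whereas [biconj] pushes second components
    forward: the inverse of [eta1] is what acts on them. *)
Lemma biconj_twdiag P Q (R T : {group S}) phi eta1 eta2 H K :
    H = twdiag P phi :> {set S * S} ->
    K = twdiag Q (eta2 \o phi \o eta1) :> {set S * S} ->
    phi @: P = T -> fiso F Q P eta1 -> fiso F T R eta2 -> biconj H K.
Proof.
move=> eH eK eT /fiso_sym[e [/fisoP[Fe imQ] _ eE]] /fisoP[Fe2 _].
apply/biconjP; exists eta2, e; rewrite (proj2_twdiag eH); split=> //.
  by rewrite (_ : proj1 H = T) //; apply: group_inj; rewrite (proj1_twdiag eH).
by rewrite eH eK; apply: map_pair_twdiag => // x Px /=; rewrite eE.
Qed.

(** A converse of [biconj_twdiag] for [phi] in [F]; the composite is then in [F] too, so that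
    [Fdiag] is closed under [biconj]. *)
Lemma biconj_twdiagP P phi H K : FT P phi -> H = twdiag P phi :> {set S * S} ->
    biconj H K ->
  exists (Q R T : {group S}) eta1 eta2, [/\ phi @: P = T, fiso F Q P eta1,
    fiso F T R eta2, K = twdiag Q (eta2 \o phi \o eta1) :> {set S * S}
    & FT Q (eta2 \o phi \o eta1)].
Proof.
move=> Fphi eH /biconjP[r [c [Fr Fc eK]]].
have [T eT isoT] := fhom_image Fphi.
have eT1 : proj1 H = T by apply: group_inj; rewrite (proj1_twdiag eH).
move: Fr Fc; rewrite eT1 (proj2_twdiag eH) => Fr Fc.
have [R _ isoR] := fhom_image Fr.
have [Q eQ /fiso_sym[e [isoe cK eE]]] := fhom_image Fc.
exists Q, R, T, e, r; split=> //.
  by rewrite -eK eH; apply: map_pair_twdiag => // x Px /=; rewrite cK.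
have /fisoP[//] := fiso_comp isoe (fiso_comp isoT isoR).
Qed.

Lemma Fdiag_biconj H K : biconj H K -> Fdiag H -> Fdiag K.
Proof.
move=> RHK /FdiagP[P [phi [Fphi eH]]]; apply/FdiagP.
have [Q [_ [_ [e1 [e2 [_ _ _ eK FQ]]]]]] := biconj_twdiagP Fphi eH RHK.
by exists Q, (e2 \o phi \o e1).
Qed.
End TwistedDiagonals.

(** * Extension of morphisms to normalizers by saturation *)

Section Transport.
Variables (p : nat) (S : finGroupType) (F : fusion_system S).
Hypotheses (pS : p.-group [set: S]) (satF : saturated p F).
Implicit Types (P Q : {group S}) (phi psi : S -> S) (H K E : {group S * S}).
Notation FT P phi := (F P [set: S]%G phi).

Lemma Nphi_normal Q phi g h : g \in 'N(Q) -> h \in 'N(phi @: Q) ->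
  {in Q, forall a, phi (a ^ g) = phi a ^ h} -> g \in Nphi Q phi.
Proof.
move=> Ng Nh gh; apply/setIdP; split=> //; apply/exists_inP; exists h => //.
by apply/forall_inP=> a Qa; rewrite gh.
Qed.

(* Sylow's theorem in AutF P corrects phi so that its extension domain is N(Q). *)
Lemma normalizer_extension P Q : fully_normalized F P -> fconj F Q P ->
  exists2 chi : S -> S, FT 'N(Q)%G chi & chi @: Q = P.
Proof.
move=> nP [phi isophi]; have [cP sylP] := satF.1 P nP.
have [FTphi ephi] := (fisoP F Q P phi).1 isophi.
have [Fphi [phi' [Fphi' phiK phi'K]]] := isophi.
have mphi : morphic Q phi by apply/morphicP; apply: fhomM Fphi.
pose f := [morphism of morphm mphi].
have injf : 'injm f by apply/injmP; apply: fhom_injP Fphi.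
have fQ : f @* Q = P by rewrite morphimEdom.
pose alpha := Aut_isom injf (subxx Q).
have alphaE s x : s \in Aut Q -> x \in Q -> alpha s (phi x) = phi (s x).
  by move=> As Qx; apply: (Aut_isomE injf (subxx Q)).
(* [B] is [phi Aut_S(Q) phi^-1], a p-subgroup of [AutF F P]. *)
pose B := ([morphism of alpha] @* AutS Q)%G.
have sBA : B \subset AutF F P.
  apply/subsetP=> _ /morphimP[s As AutSs ->]; apply/setIdP; split.
    by rewrite -fQ; apply: Aut_Aut_isom.
  case/morphimP: AutSs As => g _ Ng -> As {s}.
  have Fg : F Q Q (conjg^~ g) by apply: fhom_conj; rewrite (normP Ng).
  apply: fhom_ext (fhom_comp Fphi' (fhom_comp Fg Fphi)) => x Px /=.
  have [_ _ /subsetP sPQ] := fhom_inj Fphi'.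
  have Qx' : phi' x \in Q by rewrite sPQ ?imset_f.
  by rewrite -{2}(phi'K x Px) alphaE // norm_conj_autE.
have pB : p.-group B.
  by rewrite !morphim_pgroup // (pgroupS (subsetT _) pS).
(* [x] conjugates [B] into the Sylow subgroup [AutS P]; the corrected isomorphism is [x \o phi]. *)
have [x /setIdP[AutPx Fx] sBx] := Sylow_Jsub sylP sBA pB.
have isox : fiso F P P x.
  apply/fisoP; split; first exact: fhomT Fx.
  by have := im_autm AutPx; rewrite morphimEdom.
have [Fpsi epsi] := (fisoP F Q P _).1 (fiso_comp isophi isox).
have [chi Fchi chiE] := satF.2 Q P _ Fpsi epsi cP.
exists chi; last by rewrite -epsi; apply: eq_in_imset.
apply: fhom_res Fchi; apply/subsetP=> g Ng.
have Bg : alpha (conj_aut Q g) \in B.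
  have Ag : conj_aut Q g \in AutS Q by apply: mem_morphim.
  by apply: mem_morphim => //; apply: (subsetP (Aut_conj_aut Q 'N(Q))).
(* Conjugation by [g] on [Q], carried to [P] by [x \o phi], is conjugation by this [h]. *)
have /(subsetP sBx)/morphimP[h _ Nh eh] : alpha (conj_aut Q g) ^ x \in B :^ x.
  by rewrite memJ_conjg.
apply: (Nphi_normal Ng (h := h)); rewrite ?epsi // => a Qa /=.
have Pa : x (phi a) \in P by rewrite -epsi imset_f.
rewrite -(norm_conj_autE Nh Pa) -eh conjgE !permM permK alphaE //.
  by rewrite norm_conj_autE.
by apply: (subsetP (Aut_conj_aut Q 'N(Q))); apply: mem_morphim.
Qed.

Definition diag_rep E :=
  exists2 P, fully_normalized F P & E = twdiag P id :> {set S * S}.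

Lemma biconj_fconj H K : biconj F H K -> fconj F (proj2 H) (proj2 K).
Proof.
case/biconjP=> r [c [_ Fc eK]]; exists c; apply/fisoP.
by case: (biconj_proj eK).
Qed.

Lemma norm_twdiag H Q psi u : H = twdiag Q psi :> {set S * S} -> u \in 'N(H) ->
  [/\ u.2 \in 'N(Q), u.1 \in 'N(psi @: Q)
    & {in Q, forall q, psi (q ^ u.2) = psi q ^ u.1}].
Proof.
move=> eH Nu.
have HJ q : q \in Q -> q ^ u.2 \in Q /\ psi (q ^ u.2) = psi q ^ u.1.
  move=> Qq; have : (psi q, q) ^ u \in H.
    by rewrite memJ_norm // eH mem_twdiag /= Qq eqxx.
  by rewrite eH mem_twdiag /= => /andP[? /eqP <-].
split=> [||q /HJ[] //]; rewrite inE; apply/subsetP=> _ /imsetP[q Qq ->].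
  by case: (HJ q Qq).
by case/imsetP: Qq => a /HJ[Qa eJ] ->; rewrite -eJ imset_f.
Qed.

(** [f] is [rho] on first components and [chi] on second ones: [chi] extends an isomorphism from [Q]
    to [P] to ['N(Q)], and [rho] extends [chi psi^-1], by the extension axiom for the fully
    centralized [P]. *)
Lemma diag_rep_transport E H : diag_rep E -> biconj F H E -> Fdiag F H ->
  exists f : {morphism 'N(H) >-> S * S},
    [/\ 'injm f, f @* H = E
      & forall A : {group S * S},
          H \subset A -> A \subset 'N(H) -> biconj F A (f @* A)%G].
Proof.
case=> P nP eE RHE /FdiagP[Q [psi [Fpsi eH]]].
have QP : fconj F Q P.
  by have := biconj_fconj RHE; rewrite (proj2_twdiag eH) (proj2_twdiag eE).
have [chi Fchi chiQ] := normalizer_extension nP QP.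
have FchiQ : FT Q chi by apply: fhom_res Fchi; apply: normG.
have [T eT isoT] := fhom_image Fpsi.
have [psi' [isopsi' psiK _]] := fiso_sym isoT.
have isochi : fiso F Q P chi by apply/fisoP.
have /fisoP[Ftheta etheta] := fiso_comp isopsi' isochi.
have [rho Frho rhoE] := satF.2 T P _ Ftheta etheta (satF.1 P nP).1.
(* For [u] normalizing [H], conjugation by [u.1] on [T] corresponds under [psi] to conjugation by
   [u.2] on [Q], which [chi] turns into conjugation by [chi u.2] on [P]. *)
have s1 : proj1 'N(H)%G \subset Nphi_group T (chi \o psi').
  apply/subsetP=> b; rewrite proj1E => /imsetP[u Nu ->].
  have [Nu2 Nu1 uJ] := norm_twdiag eH Nu.
  apply: (Nphi_normal (h := chi u.2)); rewrite -?eT // ?eT ?etheta.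
    rewrite inE -chiQ; apply/subsetP=> _ /imsetP[_ /imsetP[q Qq ->] ->].
    rewrite -(fhomJ Fchi _ Nu2) ?(subsetP (normG Q) q) //.
    by rewrite imset_f // memJ_norm.
  move=> t; rewrite -eT => /imsetP[q Qq ->] /=.
  rewrite -uJ // !psiK ?memJ_norm //.
  by rewrite (fhomJ Fchi _ Nu2) ?(subsetP (normG Q) q).
have s2 : proj2 'N(H)%G \subset 'N(Q)%G.
  apply/subsetP=> a; rewrite proj2E => /imsetP[u Nu ->].
  by case: (norm_twdiag eH Nu).
have Fr := fhom_res s1 Frho; have Fc := fhom_res s2 Fchi.
have fM : {in 'N(H)%G &, {morph map_pair rho chi : u v / u * v}}.
  move=> u v Nu Nv; rewrite /map_pair /= (fhomM Fr) ?(fhomM Fc) //;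
    by rewrite ?mem_proj1 ?mem_proj2.
exists (Morphism fM); split.
- apply/injmP=> u v Nu Nv [].
  move=> /(fhom_injP Fr (mem_proj1 Nu) (mem_proj1 Nv)) e1.
  move=> /(fhom_injP Fc (mem_proj2 Nu) (mem_proj2 Nv)) e2.
  by rewrite [u]surjective_pairing e1 e2 -surjective_pairing.
- rewrite morphimEsub ?normG //= eH eE; apply: map_pair_twdiag => // x Qx.
  by rewrite rhoE -?eT ?imset_f //= psiK.
move=> A HA NA; apply/biconjP; exists rho, chi; split.
- by apply: fhom_res Fr; apply: morphimS.
- by apply: fhom_res Fc; apply: morphimS.
by rewrite /= morphimEsub.
Qed.

(** If [phi] maps [Q] onto a fully normalized [P], the pair formed by [phi psi^-1] and [phi] carries
    [(Q, psi)] to [(P, id)]. *)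
Lemma diag_rep_exists H : Fdiag F H -> exists2 E, biconj F H E & diag_rep E.
Proof.
case/FdiagP=> Q [psi [Fpsi eH]].
have [P [phi isoP] nP] := fully_normalized_exists F Q.
have [T eT isoT] := fhom_image Fpsi.
have [psi' [isopsi' psiK _]] := fiso_sym isoT.
have /fisoP[Ftheta etheta] := fiso_comp isopsi' isoP.
have [Fphi ephi] := (fisoP F Q P phi).1 isoP.
have FP : FT P id by apply: fhom_sub; apply: subsetT.
exists (Group (twdiag_group_set (fhomM FP))); last by exists P.
apply/biconjP; exists (phi \o psi'), phi; rewrite (proj2_twdiag eH); split=> //.
  by rewrite (_ : proj1 H = T) //; apply: group_inj; rewrite (proj1_twdiag eH).
rewrite eH; apply: map_pair_twdiag => // x Qx /=; by rewrite psiK.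
Qed.
End Transport.

(** * Bisets *)

Section BisetActions.
Variable S : finGroupType.

Section BisetAct.
Variable X : biset S.

(* ract alone is the restricted action of the library. *)
Definition biset_actfun (w : X) (u : S * S) : X :=
  lact u.1^-1 (Defs.ract X w u.2).

Lemma biset_actfun1 : biset_actfun^~ 1 =1 id.
Proof. by move=> w; rewrite /biset_actfun invg1 act1 lact1. Qed.

Lemma biset_actfunM w : act_morph biset_actfun w.
Proof. by move=> u v; rewrite /biset_actfun /= invMg lactM actM lract. Qed.

Definition biset_act := TotalAction biset_actfun1 biset_actfunM.

(** Under [biset_act] the pair [(b, a)] sends [w] to [b^-1 w a], so it fixes [w] exactly when
    [b w = w a]. *)
Lemma biset_stab w : 'C[w | biset_act] = bstab w.
Proof.
apply/setP=> u; rewrite [RHS]inE.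
apply/astab1P/eqP => /= [eu | eu].
  by rewrite -{1}eu /biset_actfun -lactM mulgV lact1.
by rewrite /biset_actfun -eu -lactM mulVg lact1.
Qed.

Lemma bfixE H : bfix X H = 'Fix_biset_act(H).
Proof. by apply/setP=> w; rewrite inE -biset_stab sub_astab1. Qed.
End BisetAct.

Section ActBiset.
Variables (T : finType) (to : {action S * S &-> T}).
Hypothesis free_l : forall w b, to w (b, 1) = w -> b = 1.
Hypothesis free_r : forall w a, to w (1, a) = w -> a = 1.

Let ractfun w a := to w (1, a).

Fact ractfun1 : ractfun^~ 1 =1 id.
Proof. by move=> w; apply: act1. Qed.

Fact ractfunM w : act_morph ractfun w.
Proof.
by move=> a b; rewrite /ractfun -actM; congr (to w (_, _)); rewrite mulg1.
Qed.

Fact lactfun1 w : to w (1^-1, 1) = w.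
Proof. by rewrite invg1; apply: act1. Qed.

Fact lactfunM b b' w : to w ((b * b')^-1, 1) = to (to w (b'^-1, 1)) (b^-1, 1).
Proof. by rewrite -actM; congr (to w (_, _)); rewrite /= ?mulg1 ?invMg. Qed.

Fact lractfun b a w : to (to w (b^-1, 1)) (1, a) = to (to w (1, a)) (b^-1, 1).
Proof. by rewrite -!actM; congr (to w (_, _)); rewrite /= ?mulg1 ?mul1g. Qed.

Fact lactfun_free b w : to w (b^-1, 1) = w -> b = 1.
Proof. by move/free_l/(canRL invgK); rewrite invg1. Qed.

Definition act_biset : biset S :=
  @Biset S T (fun b w => to w (b^-1, 1)) (TotalAction ractfun1 ractfunM)
    lactfun1 lactfunM lractfun lactfun_free (fun a w => @free_r w a).

Lemma act_bisetE (w : T) u : biset_act act_biset w u = to w u.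
Proof.
rewrite /biset_act /= /biset_actfun /= invgK -actM.
congr (to w _); rewrite [RHS]surjective_pairing.
by congr (_, _); rewrite /= ?mulg1 ?mul1g.
Qed.
End ActBiset.

Lemma bimorph_act (X Y : biset S) (f : X -> Y) :
  (forall w u, f (biset_act X w u) = biset_act Y (f w) u) -> bimorph f.
Proof.
move=> fJ; split=> [b w | a w].
  by have := fJ w (b^-1, 1); rewrite /= /biset_actfun /= invgK !act1.
by have := fJ w (1, a); rewrite /= /biset_actfun /= invg1 !lact1.
Qed.
End BisetActions.

(** * Characteristic bisets as actions, and their cardinality modulo p *)

Section Characteristic.
Variables (p : nat) (S : finGroupType) (F : fusion_system S).
Hypotheses (p_pr : prime p) (pS : p.-group [set: S]) (satF : saturated p F).
Implicit Types (P Q : {group S}) (phi psi : S -> S) (H K E : {group S * S}).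
Notation FT P phi := (F P [set: S]%G phi).

Definition semichar_action (T : finType) (to : {action S * S &-> T}) :=
  (forall x, Fdiag F 'C[x | to]%G) /\
  (forall H K, biconj F H K -> #|'Fix_to(H)| = #|'Fix_to(K)|).

(** On the twisted diagonals of F-morphisms the two forms of stability match by [biconj_twdiagP].
    Other subgroups fix no point of an F-generated biset, since [Fdiag] passes to subgroups of
    stabilizers. *)
Lemma semichar_biset_act (X : biset S) :
  Fsemicharacteristic F X <-> semichar_action (biset_act X).
Proof.
split=> [[genX stX] | [genX stX]]; split.
- move=> x; apply/FdiagP; have [P [phi [Fphi eC]]] := genX x.
  by exists P, phi; rewrite /= biset_stab.
- have genX' x : Fdiag F 'C[x | biset_act X]%G.
    apply/FdiagP; have [P [phi [Fphi eC]]] := genX x.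
    by exists P, phi; rewrite /= biset_stab.
  move=> H K RHK; have [DH | nDH] := boolP (Fdiag F H).
    have [P [phi [Fphi eH]]] := FdiagP F H DH.
    have [Q [R [T [e1 [e2 [eT iso1 iso2 eK _]]]]]] :=
      biconj_twdiagP Fphi eH RHK.
    rewrite -!bfixE eH eK; apply: (stX P Q R T) => //.
    exact: fhom_inj Fphi.
  have nFix L : ~~ Fdiag F L -> #|'Fix_(biset_act X)(L)| = 0.
    move=> nDL; apply: eq_card0 => x; apply: contraNF nDL.
    by rewrite -sub_astab1 => /(@Fdiag_sub _ F L 'C[x | biset_act X]%G)->.
  rewrite !nFix //; apply: contra nDH; apply: Fdiag_biconj.
  by rewrite biconj_sym.
- move=> x; have [P [phi [Fphi eC]]] := FdiagP F _ (genX x).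
  by exists P, phi; rewrite -biset_stab.
move=> P Q R T phi e1 e2 [/morphicP phiM _ _] eT iso1 iso2.
have [F1 im1] := (fisoP F Q P e1).1 iso1.
have [F2 _] := (fisoP F T R e2).1 iso2.
have eM : {in Q &, {morph e2 \o phi \o e1 : x y / x * y}}.
  have Pe1 x : x \in Q -> e1 x \in P by move=> Qx; rewrite -im1 imset_f.
  have Te1 x : x \in Q -> phi (e1 x) \in T.
    by move=> /Pe1 Px; rewrite -eT imset_f.
  by move=> x y Qx Qy /=; rewrite (fhomM F1) // phiM ?Pe1 // (fhomM F2) ?Te1.
pose H := Group (twdiag_group_set phiM); pose K := Group (twdiag_group_set eM).
rewrite !bfixE; apply: (stX H K).
exact: (biconj_twdiag (H := H) (K := K) _ _ eT iso1 iso2).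
Qed.

(** Stabilizers have order at most [#|S|], so one that contains [H] equals [H]. *)
Lemma fix_top (T : finType) (to : {action S * S &-> T}) H :
    (forall x, Fdiag F 'C[x | to]%G) -> #|H| = #|S| ->
  #|'Fix_to(H)| = mult to H.
Proof.
move=> DC cH; apply: eq_card => x; rewrite inE -sub_astab1 eq_sym eqEcard cH.
have [P [phi [_ /= ->]]] := FdiagP F _ (DC x).
by rewrite card_twdiag max_card andbT.
Qed.

(** The normalizer of [(S, phi)] consists of the pairs [(z * phi a, a)] with [z] central. *)
Lemma norm_top_index H phi : FT [set: S]%G phi ->
  H = twdiag [set: S]%G phi :> {set S * S} ->
  #|'N(H) : H| = #|'C([set: S])|.
Proof.
move=> Fphi eH; have cH : #|H| = #|S| by rewrite eH card_twdiag cardsT.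
have phiJ x y : phi (x ^ y) = phi x ^ phi y by rewrite (fhomJ Fphi) ?inE.
have phi_surj x : exists y, x = phi y.
  have phi_inj : injective phi.
    by move=> a b; apply: (fhom_injP Fphi); rewrite inE.
  by exists (invF phi_inj x); rewrite f_invF.
have eN : 'N(H) = [set (u.1 * phi u.2, u.2) |
                    u in setX 'C([set: S]) [set: S]] :> {set S * S}.
  apply/setP=> u; apply/idP/imsetP => [Nu | [[z a] /setXP[/= Cz _] ->]].
    have [_ _ uJ] := norm_twdiag eH Nu.
    exists (u.1 * (phi u.2)^-1, u.2); last by rewrite /= mulgKV -surjective_pairing.
    rewrite !inE andbT /=; apply/centP=> x _; have [y ->] := phi_surj x.
    apply: commute_sym; apply/commgP/conjg_fixP.
    by rewrite conjgM -uJ ?inE // phiJ conjgK.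
  rewrite inE; apply/subsetP=> _ /imsetP[v Hv ->]; move: Hv.
  rewrite eH !mem_twdiag => /andP[_ /eqP ev]; rewrite inE.
  apply/eqP; transitivity (v.1 ^ (z * phi a)) => //.
  transitivity (phi (v.2 ^ a)) => //; rewrite ev conjgM phiJ; congr (_ ^ _).
  apply/conjg_fixP/commgP.
  by apply: commute_sym; apply: (centP Cz); rewrite inE.
have cN : #|'N(H)| = (#|'C([set: S])| * #|S|)%N.
  rewrite eN card_imset ?cardsX ?cardsT // => -[z a] [z' a'] [+ eaa'] /=.
  by rewrite eaa' => /mulIg->.
have := Lagrange (normG H); rewrite cH cN mulnC => /eqP.
by rewrite eqn_pmul2r -?cardsT ?cardG_gt0 // => /eqP.
Qed.

Lemma dvdn_index_proper P : P \proper [set: S] -> p %| #|[set: S] : P|.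
Proof.
move=> ltP; have [n cS] := p_natP pS.
have : #|[set: S] : P| %| p ^ n by rewrite -cS dvdn_indexg.
case/(dvdn_pfactor _ _ p_pr)=> [[|m] _ ei]; last by rewrite ei expnS dvdn_mulr.
have := proper_card ltP; rewrite -(Lagrange (subsetT P)) ei.
by rewrite muln1 ltnn.
Qed.

(** Points with stabilizer of order [#|S|] are equally many for each of the types [(S, s)], [s] in
    [AutF]. Any other stabilizer is some [(P, phi)] with [P] proper, and its orbit has length
    [#|S : P|] times [#|S|]. *)
Lemma card_action_mod (T : finType) (to : {action S * S &-> T}) E :
    semichar_action to -> E = twdiag [set: S]%G id :> {set S * S} ->
  exists j, #|T| = (#|AutF F [set: S]%G| * mult to E + p * #|S| * j)%N.
Proof.
move=> [DC fixR] eE.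
have cE : #|E| = #|S| by rewrite eE card_twdiag cardsT.
pose top := [set x | #|'C[x | to]| == #|S|].
have /dvdnP[j ej] : (p * #|S|)%N %| #|~: top|.
  apply: (@dvdn_acts _ _ to [set: S * S]%G) => [|x].
    by apply/actsP=> a _ x; rewrite !inE astab1_act cardJg.
  rewrite !inE setTI => ntop.
  have [P [phi [_ /= eC]]] := FdiagP F _ (DC x).
  have cC : #|'C[x | to]| = #|P| by rewrite eC card_twdiag.
  have cSP := Lagrange (subsetT P).
  have : #|[set: S * S] : 'C[x | to]| = (#|[set: S] : P| * #|S|)%N.
    apply/eqP; rewrite -(eqn_pmul2l (cardG_gt0 P)) mulnA cSP -cC.
    by rewrite (Lagrange (subsetT _)) !cardsT card_prod.
  move=> ->; rewrite dvdn_mul ?dvdn_index_proper //.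
  by rewrite properEcard subsetT cardsT -cC ltn_neqAle ntop cC max_card.
exists j; rewrite -(cardsC top) ej [(j * _)%N]mulnC; congr (_ + _)%N.
pose tw (s : {perm S}) := twdiag [set: S]%G s.
have Fs s : s \in AutF F [set: S]%G -> FT [set: S]%G s by case/setIdP.
have tw_inj s s' : s \in AutF F [set: S]%G -> tw s = tw s' -> s = s'.
  move=> _ /setP ess; apply/permP=> a; have := ess (s a, a).
  by rewrite !mem_twdiag inE eqxx => /esym/eqP.
have twE x : x \in top ->
    exists2 s, s \in AutF F [set: S]%G & 'C[x | to] = tw s.
  rewrite inE => /eqP topx; have [P [phi [Fphi /= eC]]] := FdiagP F _ (DC x).
  have eP : P = [set: S]%G.
    apply: group_inj; apply/eqP; rewrite eqEcard subsetT.
    by rewrite -(card_twdiag P phi) -eC topx cardsT leqnn.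
  rewrite {}eP in Fphi eC.
  have phi_inj : injective phi.
    by move=> a b; apply: (fhom_injP Fphi); rewrite inE.
  exists (perm phi_inj); last by rewrite eC; apply: eq_imset => a; rewrite permE.
  apply/setIdP; split; last by apply: fhom_ext Fphi => a _; rewrite permE.
  rewrite inE; apply/andP; split; first by apply/subsetP=> a _; rewrite inE.
  by apply/morphicP=> a b Sa Sb; rewrite !permE (fhomM Fphi).
(* Double counting: a point of [top] has exactly one type [s], so [top] can be counted type by
   type. *)
have topE x : (x \in top) =
    \sum_(s in AutF F [set: S]%G | 'C[x | to] == tw s) 1 :> nat.
  case: (boolP (x \in top)) => [/twE[s As eC] | ntop].
    rewrite (big_pred1 s) // => s'; rewrite eC.
    apply/andP/eqP => [[As' /eqP/esym/tw_inj->//] | ->]; by rewrite As eqxx.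
  rewrite big_pred0 // => s; apply: contraNF ntop => /andP[_ /eqP eC].
  by rewrite inE eC card_twdiag cardsT.
rewrite -sum1_card big_mkcond (eq_bigr _ (fun x _ => topE x)) /=.
rewrite (exchange_big_dep (mem (AutF F [set: S]%G))) //=.
  rewrite -sum_nat_const; apply: eq_bigr => s As.
  pose Hs := Group (twdiag_group_set (fhomM (Fs s As))).
  have eHs : Hs = twdiag [set: S]%G s :> {set S * S} by [].
  (* The pair formed by [s] and [id] carries [(S, id)] to [(S, s)]; stability then equates their
     multiplicities. *)
  have EHs : biconj F E Hs.
    apply/biconjP; exists s, id; rewrite (proj2_twdiag eE) fhom_sub ?subsetT //.
    rewrite (_ : proj1 E = [set: S]%G); last first.
      by apply: group_inj; rewrite (proj1_twdiag eE) imset_id.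
    split=> //; first exact: (Fs s).
    by rewrite eE eHs; apply: map_pair_twdiag; rewrite ?imset_id.
  rewrite -(fix_top DC cE) (fixR E Hs EHs) (fix_top DC) ?card_twdiag ?cardsT //.
  by rewrite As /= sum1dep_card.
by move=> x s _ /andP[].
Qed.

(* |C(S)| = |N(H) : H| for H = (S, phi): one orbit of each type (S, phi). *)
Definition seed H := if #|H| == #|S| then #|'C([set: S])| else 0.

Lemma diag_repD E : diag_rep F E -> Fdiag F E.
Proof.
case=> P _ eE; apply/FdiagP; exists P, id; split=> //.
by apply: fhom_sub; apply: subsetT.
Qed.

Lemma top_twdiag H : Fdiag F H -> #|H| = #|S| ->
  exists2 phi, FT [set: S]%G phi & H = twdiag [set: S]%G phi :> {set S * S}.
Proof.
case/FdiagP=> P [phi [Fphi eH]]; rewrite eH card_twdiag => cP.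
have eP : P = [set: S]%G.
  by apply: group_inj; apply/eqP; rewrite eqEcard subsetT cP cardsT leqnn.
by move: Fphi; rewrite eP => Fphi; exists phi.
Qed.

Lemma seed_dvdn H : Fdiag F H -> #|'N(H) : H| %| seed H.
Proof.
rewrite /seed; case: eqP => [cH DH|]; last by rewrite dvdn0.
have [phi Fphi eH] := top_twdiag DH cH.
by rewrite (norm_top_index Fphi eH).
Qed.

Lemma fully_normalizedT : fully_normalized F [set: S]%G.
Proof.
move=> Q _; apply: subset_leq_card.
exact: subset_trans (subsetT _) (normG [set: S]%G).
Qed.

(** [k] is the order of [Out_F(S)], prime to [p] because [AutS] is a Sylow subgroup of [AutF]; and
    [AutS] of the whole group is its quotient by its center. *)
Lemma card_AutF_center : exists2 k, ~~ (p %| k) &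
  (#|AutF F [set: S]%G| * #|'C([set: S])| = k * #|S|)%N.
Proof.
have [_ /and3P[sA _ p'A]] := satF.1 _ fully_normalizedT.
exists #|AutF F [set: S]%G : AutS [set: S]%G|.
  by move: p'A; rewrite p'natE.
rewrite -(Lagrange sA) mulnAC mulnC; congr (_ * _)%N.
have NT : 'N([set: S]%G) = [set: S].
  by apply/eqP; rewrite eqEsubset subsetT normG.
rewrite card_morphim ker_conj_aut setIid /= NT mulnC -cardsT.
by rewrite (Lagrange (subsetT 'C([set: S])%G)).
Qed.
End Characteristic.

(** Without points of stabilizer [(S, id)], [card_action_mod] would make [#|X| %/ #|S|] divisible by
    [p]. Their number is thus positive, and a multiple of the seed by [dvdn_mult]. *)
Lemma characteristic_dominated (p : nat) (S : finGroupType) (F : fusion_system S)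
    (X : biset S) :
    prime p -> p.-group [set: S] -> saturated p F -> Fcharacteristic p F X ->
  dominated (Fdiag F) (biconj F) (diag_rep F) (@seed S) (biset_act X).
Proof.
move=> p_pr pS satF [/semichar_biset_act[DC fixR] pX]; split=> // E repE.
rewrite /seed; case: eqP => // cE.
have [P _ eE] := repE; have eP : P = [set: S]%G.
  apply: group_inj; apply/eqP.
  by rewrite eqEcard subsetT cardsT -cE eE card_twdiag leqnn.
rewrite {}eP in eE.
have Fid : F [set: S]%G [set: S]%G id by apply: fhom_sub.
rewrite -(norm_top_index Fid eE); apply: dvdn_leq (dvdn_mult _ _).
rewrite lt0n; apply/eqP=> m0; case: pX.
have [j ->] := card_action_mod p_pr pS (conj DC fixR) eE.
by rewrite m0 muln0 mulnAC cardsT mulnK -?cardsT ?cardG_gt0 // modnMr mod0n.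
Qed.

(** * Existence and uniqueness of the minimal characteristic biset *)

Theorem theoremA (p : nat) (S : finGroupType) (F : fusion_system S) :
  prime p -> (p.-group [set: S])%g -> saturated p F ->
  exists Lambda : biset S,
    [/\ minimal_Fcharacteristic p F Lambda,
        forall Omega : biset S, Fcharacteristic p F Omega ->
          biset_sub Lambda Omega
      & forall Lambda' : biset S, minimal_Fcharacteristic p F Lambda' ->
          biset_iso Lambda Lambda'].
Proof.
move=> p_pr pS satF.
have pSS : p.-group [set: S * S].
  by rewrite /pgroup cardsT card_prod -!cardsT pnatM [X in X && X](pS).
have [|T [to [DC fixR multE embed]]] := @minimal_stable_action _ p (Fdiag F)
  (biconj F) (diag_rep F) (@seed S) pSS (@Fdiag_sub S F) (@Fdiag_biconj S F)
  (@biconj_refl S F) (@biconj_sym S F) (@biconj_trans S F) (@biconj_card S F)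
  (@biconj_conj S F) (@diag_repD S F) (@diag_rep_exists S F)
  (diag_rep_transport pS satF) _ (@seed_dvdn S F).
  by move=> H K RHK; rewrite /seed (biconj_card RHK).
(* Both actions are free because stabilizers are graphs of injective morphisms. *)
have stab_free x u : to x u = x -> u.2 = 1 -> u.1 = 1.
  move=> /astab1P Cu u2; have [P [phi [Fphi eC]]] := FdiagP F _ (DC x).
  by move: Cu; rewrite eC mem_twdiag u2 => /andP[_ /eqP->]; apply: fhom1 Fphi.
have stab_free2 x u : to x u = x -> u.1 = 1 -> u.2 = 1.
  move=> /astab1P Cu u1; have [P [phi [Fphi eC]]] := FdiagP F _ (DC x).
  move: Cu; rewrite eC mem_twdiag u1 => /andP[Pu /eqP e1].
  by apply: (fhom_injP Fphi); rewrite ?group1 // -e1 (fhom1 Fphi).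
pose L := act_biset (fun w b e => stab_free w (b, 1) e erefl)
                    (fun w a e => stab_free2 w (1, a) e erefl).
have LE (w : L) u : biset_act L w u = to w u by apply: act_bisetE.
have LC w : 'C[w | biset_act L] = 'C[w | to].
  by apply/setP=> u; apply/astab1P/astab1P; rewrite LE.
have Lfix (H : {set S * S}) : #|'Fix_(biset_act L)(H)| = #|'Fix_to(H)|.
  by apply: eq_card => w; rewrite -!sub_astab1 LC.
have Lsemi : semichar_action F (biset_act L).
  split=> [w | H K RHK]; last by rewrite !Lfix; apply: fixR.
  rewrite (_ : 'C[w | biset_act L]%G = 'C[w | to]%G) //.
  by apply: group_inj; apply: LC.
have charL : Fcharacteristic p F L.
  split; first exact/semichar_biset_act.
  have Fid : F [set: S]%G [set: S]%G id by apply: fhom_sub.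
  pose E := Group (twdiag_group_set (fhomM Fid)).
  have cE : #|E| = #|S| by rewrite card_twdiag cardsT.
  have nS : fully_normalized F [set: S]%G by apply: fully_normalizedT.
  have repE : diag_rep F E by exists [set: S]%G.
  have eE : E = twdiag [set: S]%G id :> {set S * S} by [].
  have [j ->] := card_action_mod p_pr pS Lsemi eE.
  have -> : mult (biset_act L) E = #|'C([set: S])|.
    transitivity (seed E); last by rewrite /seed cE eqxx.
    by rewrite -(multE E repE) -(fix_top Lsemi.1 cE) -(fix_top DC cE) Lfix.
  (* The quotient of [#|L|] by [#|S|] is [k + p * j], with [k] prime to [p]. *)
  have [k pk ->] := card_AutF_center p_pr satF.
  rewrite mulnAC -mulnDl cardsT mulnK -?cardsT ?cardG_gt0 //.
  by rewrite addnC mulnC modnMDl mod0n => /eqP; rewrite -/(dvdn p k) (negPf pk).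
have subL (Omega : biset S) : Fcharacteristic p F Omega -> biset_sub L Omega.
  move/(characteristic_dominated p_pr pS satF)/embed => [f fJ f_inj].
  by exists f => //; apply: bimorph_act => w u; rewrite LE fJ.
(* Injections both ways between finite sets force equal cardinalities, so the injective map [f] is
   bijective. *)
have iso_of_sub (X Y : biset S) :
    biset_sub X Y -> biset_sub Y X -> biset_iso X Y.
  move=> [f fM f_inj] [g _ g_inj]; exists f => //; apply: inj_card_bij => //.
  exact: leq_card g_inj.
exists L; split=> //.
  by split=> // Y charY subY; apply: iso_of_sub subY (subL Y charY).
move=> L' [charL' minL'].
exact: minL' charL (subL L' charL').
Qed.
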